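(* Let $\Gamma=\{v_0,\dots,v_n\}$ be a simplex in $\mathfrak B_d$, with representatives ordered so that $L_{v_0}\subset L_{v_1}\subset\cdots\subset L_{v_n}\subset\pi^{-1}L_{v_0}$, and let $\underline x=(x_i)_{0\le i\le n}$ be a dimension vector of $Q(\Gamma)$. Let $J=\{(i,j)\mid 0\le i\le n,\ i\le j\le n+i\}$. Then a tuple of integers $(d_{i,j})_{(i,j)\in J}$ is contained in the set $\Phi(\mathrm{Gr}(\underline x,M_\Gamma))$ of rank vectors if and only if (1) for each $(i,j)\in J$, $d_{i,j}+d_{i-1,j+1}-d_{i,j+1}-d_{i-1,j}\ge0$; and (2) $d_{i,i}=x_i$ and $d_{i,i}-d_{i,i+1}\le\Phi_{i,i}(M_\Gamma)-\Phi_{i,i+1}(M_\Gamma)=\dim\ker f_{i,i+1}$ for $0\le i\le n$. Here, for arbitrary integers $i,j$, one sets $d_{i,j}=d_{i+n+1,j+n+1}$ if $0\le j-i\le n$, and $d_{i,j}=0$ otherwise.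
   Context: $R$ is a discrete valuation ring with fraction field $K$, uniformizer $\pi$ and algebraically closed residue field $\kappa$. A lattice in $K^d$ is a free $R$-submodule $L\subset K^d$ with $L\otimes_RK\to K^d$ an isomorphism; $[L]$ is its homothety class. Distinct classes are adjacent if they have representatives with $\pi L_1\subset L_2\subset L_1$; the building $\mathfrak B_d$ is the flag complex of homothety classes under adjacency, so a simplex is a finite set of pairwise adjacent classes, and it always admits representatives ordered in a chain $L_{v_0}\subset\cdots\subset L_{v_n}\subset\pi^{-1}L_{v_0}$. For $u,v\in\Gamma$ let $n_{u,v}$ be the minimal integer with $\pi^{n_{u,v}}L_u\subset L_v$, put $\overline L_v=L_v/\pi L_v$, and let $f_{u,v}:\overline L_u\to\overline L_v$ be induced by multiplication by $\pi^{n_{u,v}}$. Indices are extended by $v_{i+n+1}=v_i$, and $f_{i,j}=f_{v_i,v_j}$. For a simplex, the quiver $Q(\Gamma)$ is the cycle $v_0\to v_1\to\cdots\to v_n\to v_0$, and $M_\Gamma=(\overline L_{v_i})_i$ is its representation with maps $f_{i,i+1}$. $\mathrm{Gr}(\underline x,M_\Gamma)$ is the quiver Grassmannian over $\kappa$ of sub-representations $(U_{v_i})_i$ of $M_\Gamma$ with $\dim U_{v_i}=x_i$. The rank vector of a sub-representation $M=(U_v)_v$ is $\Phi(M)=(\Phi_{u,v}(M))_{u,v\in\Gamma}$ with $\Phi_{u,v}(M)=\dim f_{u,v}(U_u)$; write $\Phi_{i,j}=\Phi_{v_i,v_j}$. It is regarded as a tuple $(d_{i,j})_{(i,j)\in J}$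 via $d_{i,j}=\Phi_{i,j}(M)$ for $(i,j)\in J$ with $j\le n$, and $d_{i,j}=\Phi_{i,j-(n+1)}(M)$ otherwise; so $d_{i,i}=\dim U_{v_i}$.
   Formalization: For n = 0, where f_{0,1} is the identity and (2) as written fails, Φ_{0,1}(M_Γ) is taken to be 0 by the same extension rule as d_{i,j}, and the equality of Φ_{i,i}(M_Γ)-Φ_{i,i+1}(M_Γ) with dim ker f_{i,i+1} is asserted only for n ≥ 1. *)

(* Defs.v *)
From HB Require Import structures.
From mathcomp Require Import all_boot all_order all_algebra.
From mathcomp Require Import all_classical.
From mathcomp Require Import zify.

Set Implicit Arguments.
Unset Strict Implicit.
Unset Printing Implicit Defensive.

Import Order.TTheory GRing.Theory Num.Theory.

Local Open Scope classical_set_scope.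
Local Open Scope ring_scope.

Notation "x %:F" := (@FracField.tofrac _ x) : ring_scope.

(* R is the valuation ring of a normalized discrete valuation v of its
   fraction field, and v pi = 1.  The value of v at 0 is irrelevant. *)
Definition dvr_with_uniformizer (R : idomainType) (pi : R) : Prop :=
  exists v : {fraction R} -> int,
    [/\ forall x y, x != 0 -> y != 0 -> v (x * y) = v x + v y,
        forall x y, x != 0 -> y != 0 -> x + y != 0 ->
          Num.min (v x) (v y) <= v (x + y),
        forall x, x != 0 -> (exists a : R, x = a%:F) <-> 0 <= v x,
        pi != 0
      & v pi%:F = 1].

Definition residue_morphism (R : idomainType) (pi : R) (kappa : fieldType)
    (res : {rmorphism R -> kappa}) : Prop :=
  (forall y, exists a, res a = y) /\
  (forall a, res a = 0 <-> exists b, a = pi * b).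

Definition scale_set (K : fieldType) (d : nat) (c : K) (L : set 'rV[K]_d) :
  set 'rV[K]_d := [set c *: x | x in L].

(* The rows of B form an R-basis of L; for a free R-submodule L of K^d, the map
   from the scalar extension of L to K^d is an isomorphism exactly when an
   R-basis of L is a K-basis of K^d. *)
Definition lattice (R : idomainType) (d : nat) (L : set 'rV[{fraction R}]_d) :
  Prop :=
  exists B : 'M[{fraction R}]_d,
    B \in unitmx /\
    L = [set map_mx (@FracField.tofrac R) u *m B | u in [set: 'rV[R]_d]].

Definition homothety_class (K : fieldType) (d : nat) (L : set 'rV[K]_d) :
  set (set 'rV[K]_d) := [set scale_set c L | c in [set c : K | c != 0]].

Definition building_vertex (R : idomainType) (d : nat)
    (X : set (set 'rV[{fraction R}]_d)) : Prop :=
  exists2 L, lattice L & X = homothety_class L.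

Definition adjacent (R : idomainType) (pi : R) (d : nat)
    (X Y : set (set 'rV[{fraction R}]_d)) : Prop :=
  X <> Y /\
  exists L1 L2, [/\ X L1, Y L2, scale_set pi%:F L1 `<=` L2 & L2 `<=` L1].

Definition building_simplex (R : idomainType) (pi : R) (d : nat)
    (Gamma : set (set (set 'rV[{fraction R}]_d))) : Prop :=
  [/\ finite_set Gamma, Gamma !=set0,
      forall X, Gamma X -> building_vertex X
    & forall X Y, Gamma X -> Gamma Y -> X <> Y -> adjacent pi X Y].

(* L / pi L with its kappa-structure, given by its universal description: a
   kappa-space with a surjective R-semilinear map from L whose kernel is pi L.
   Values of red_map outside L are irrelevant.  See [reduction_exists]. *)
Record reduction (R : idomainType) (pi : R) (kappa : fieldType)
    (res : {rmorphism R -> kappa}) (d : nat) (L : set 'rV[{fraction R}]_d) :=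
  Reduction {
    red_space : vectType kappa;
    red_map : 'rV[{fraction R}]_d -> red_space;
    red_mapD : forall x y, L x -> L y ->
      red_map (x + y) = red_map x + red_map y;
    red_mapZ : forall (a : R) x, L x -> red_map (a%:F *: x) = res a *: red_map x;
    red_map_surj : forall y, exists2 x, L x & red_map x = y;
    red_map_ker : forall x, L x -> red_map x = 0 <-> scale_set pi%:F L x }.

(* n_{u,v}; the default value is only used when no minimum exists. *)
Definition shift_exponent (R : idomainType) (pi : R) (d : nat)
    (Lu Lv : set 'rV[{fraction R}]_d) : int :=
  xget 0 [set m : int | scale_set (pi%:F ^ m) Lu `<=` Lv /\
            forall m' : int, scale_set (pi%:F ^ m') Lu `<=` Lv -> m <= m'].

(* f_{u,v}: lift to L_u, multiply by pi ^ n_{u,v}, reduce modulo pi L_v. *)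
Definition induced_map (R : idomainType) (pi : R) (kappa : fieldType)
    (res : {rmorphism R -> kappa}) (d : nat)
    (Lu Lv : set 'rV[{fraction R}]_d)
    (Mu : reduction pi res Lu) (Mv : reduction pi res Lv) :
  'Hom(red_space Mu, red_space Mv) :=
  linfun (fun y : red_space Mu =>
    red_map Mv (pi%:F ^ shift_exponent pi Lu Lv *:
                xget 0 [set x | Lu x /\ red_map Mu x = y])).

Section QuiverRepresentation.
Variables (kappa : fieldType) (n : nat) (V : 'I_n.+1 -> vectType kappa).
Variable f : forall i j : 'I_n.+1, 'Hom(V i, V j).

(* kappa-points of the quiver Grassmannian of the cyclic quiver
   v_0 -> v_1 -> ... -> v_n -> v_0; [ordS] is the cyclic successor. *)
Definition quiver_grassmannian (x : 'I_n.+1 -> nat) :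
  set (forall i, {vspace V i}) :=
  [set U | (forall i, (f i (ordS i) @: U i <= U (ordS i))%VS) /\
           (forall i, \dim (U i) = x i)].

Definition rank_vector (U : forall i, {vspace V i}) (i j : 'I_n.+1) : nat :=
  \dim (f i j @: U i)%VS.

End QuiverRepresentation.

Definition index_J (n : nat) : Type :=
  {p : nat * nat | (p.1 <= n)%N && (p.1 <= p.2 <= n + p.1)%N}.

Definition rank_tuple (n : nat) (Phi : 'I_n.+1 -> 'I_n.+1 -> nat) :
  index_J n -> int := fun p =>
  let: (i, j) := val p in
  (Phi (inord i) (inord (if (j <= n)%N then j else j - n.+1)%N))%:Z.

(* The extension of a tuple to all pairs of integers: periodic under
   (i, j) |-> (i + n + 1, j + n + 1), and zero unless 0 <= j - i <= n; the pair
   (i, j) is first translated so that 0 <= i <= n. *)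
Definition extend_tuple (n : nat) (t : index_J n -> int) (i j : int) : int :=
  if 0 <= j - i <= n%:Z then
    let i0 := `|(i %% n.+1%:Z)%Z|%N in
    if insub (i0, i0 + `|j - i|)%N is Some p then t p else 0
  else 0.

Lemma extend_tuple_J (n : nat) (t : index_J n -> int) (p : index_J n) :
  extend_tuple t (val p).1 (val p).2 = t p.
Proof.
case: p => -[i j] /= hij; have /andP[hi /andP[hl hu]] := hij.
rewrite /extend_tuple ifT; last by lia.
have -> : `|((i : int) %% n.+1%:Z)%Z|%N = i by rewrite modz_small; lia.
have -> : (i + `|(j : int) - (i : int)| = j)%N by lia.
by rewrite insubT.
Qed.

Lemma extend_tuple_periodic (n : nat) (t : index_J n -> int) (i j : int) :
  extend_tuple t (i + n.+1%:Z) (j + n.+1%:Z) = extend_tuple t i j.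
Proof.
rewrite /extend_tuple modzDr.
by have -> : j + n.+1%:Z - (i + n.+1%:Z) = j - i by lia.
Qed.

Lemma extend_tuple_out (n : nat) (t : index_J n -> int) (i j : int) :
  ~~ (0 <= j - i <= n%:Z) -> extend_tuple t i j = 0.
Proof. by rewrite /extend_tuple => /negbTE ->. Qed.

Lemma reduction_exists (R : idomainType) (pi : R) (kappa : fieldType)
    (res : {rmorphism R -> kappa}) (d : nat) (L : set 'rV[{fraction R}]_d) :
  residue_morphism pi res -> lattice L -> inhabited (reduction pi res L).
Proof.
move=> [res_surj res_ker] [B [Bu LE]].
pose F := @FracField.tofrac R.
have Finj (u w : 'rV[R]_d) : map_mx F u = map_mx F w -> u = w.
  move=> /rowP uw; apply/rowP => j; have := uw j; rewrite !mxE => /eqP.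
  by rewrite tofrac_eq => /eqP.
pose lift (x : 'rV[{fraction R}]_d) : 'rV[R]_d :=
  xget 0 [set u | map_mx F u *m B = x].
have coordK u : lift (map_mx F u *m B) = u.
  rewrite /lift; case: xgetP => [w _ /= /(can_inj (mulmxK Bu))|]; last first.
    by move=> /(_ u) /=.
  exact: Finj.
have mapF u : L (map_mx F u *m B) by rewrite LE; exists u.
pose red x : 'rV[kappa]_d := map_mx res (lift x).
have LP x : L x -> exists u, x = map_mx F u *m B.
  by rewrite LE => -[u _ <-]; exists u.
constructor; apply: (@Reduction R pi kappa res d L 'rV[kappa]_d red).
- move=> x y /LP[u ->] /LP[w ->].
  by rewrite -mulmxDl -map_mxD /red !coordK map_mxD.
- move=> a x /LP[u ->].
  by rewrite scalemxAl -map_mxZ /red !coordK map_mxZ.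
- move=> y; have /choice[g gE] : forall j, exists a, res a = y 0 j.
    by move=> j; exact: res_surj.
  exists (map_mx F (\row_j g j) *m B); first exact: mapF.
  by rewrite /red coordK; apply/rowP => j; rewrite !mxE gE.
- move=> x /LP[u ->]; rewrite /red coordK; split.
    move=> /rowP u0.
    have /choice[g gE] : forall j, exists b, u 0 j = pi * b.
      by move=> j; apply/res_ker; have := u0 j; rewrite !mxE.
    exists (map_mx F (\row_j g j) *m B); first exact: mapF.
    rewrite scalemxAl -map_mxZ; congr (map_mx _ _ *m _).
    by apply/rowP => j; rewrite !mxE gE.
  move=> [_ /LP[w ->]]; rewrite scalemxAl -map_mxZ.
  move=> /(can_inj (mulmxK Bu)) /Finj <-.
  by apply/rowP => j; rewrite !mxE; apply/res_ker; exists (w 0 j).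
Qed.

(* Main.v *)
Require Import Defs.
From HB Require Import structures.
From mathcomp Require Import all_boot all_order all_algebra.
From mathcomp Require Import all_classical.
From mathcomp Require Import zify.

Set Implicit Arguments.
Unset Strict Implicit.
Unset Printing Implicit Defensive.

Import Order.TTheory GRing.Theory Num.Theory.

Local Open Scope classical_set_scope.
Local Open Scope ring_scope.

(* The compositions of the maps f_{i,j} of M_Gamma are again maps f_{i,k}, or
   zero once they go all the way around the cycle, and ker f_{i,j} = im f_{j,i}:
   M_Gamma is a sum of uniserial representations of length n + 1.  Hence every
   sub-representation is a sum of intervals of length at most n + 1, and
   d_{i,j} - d_{i,j+1} counts the intervals that contain i and have their socle
   at j.  This number is the dimension of f_{i,j}(U_i) cap ker f_{j,j+1}, so it
   grows with i up to j and is then bounded by dim ker f_{j,j+1}; this is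
   (1) and (2).  Conversely, fix a basis of each ker f_{b,b+1} and lift it back
   along the n steps of the cycle from b + 1 to b.  At the vertex i take the
   images of the lifts of the first d_{i,b} - d_{i,b+1} vectors of each basis;
   they are linearly independent, because an interval is detected by its socle,
   and the ranks telescope to d_{i,j}. *)

(** * Distances along the cyclic quiver *)

Section CyclicDistance.
Variable n : nat.
Implicit Types i j k : 'I_n.+1.

(** How often the path from [i] to [j] uses the arrow from [n] to [0]; for the lattice chain this is
    the exponent $n_{i,j}$. *)
Definition wind i j : nat := (j < i)%N.

Definition cdist i j : nat := (j + wind i j * n.+1 - i)%N.

Lemma val_ordS i : ordS i = (if i == n :> nat then 0 else i.+1)%N :> nat.
Proof.
rewrite /=; case: eqP => [->|ni]; first by rewrite modnn.
by rewrite modn_small //; have := ltn_ord i; lia.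
Qed.

Lemma ordS_eq i j :
  (ordS i == j) = ((if i == n :> nat then 0 else i.+1)%N == j).
Proof. by rewrite -val_ordS. Qed.

Lemma cdist_le i j : (cdist i j <= n)%N.
Proof. by rewrite /cdist /wind; have := ltn_ord i; have := ltn_ord j; lia. Qed.

Lemma cdistii i : cdist i i = 0.
Proof. by rewrite /cdist /wind; lia. Qed.

Lemma cdistE i j : (i + cdist i j = j + wind i j * n.+1)%N.
Proof. by rewrite /cdist /wind; have := ltn_ord i; have := ltn_ord j; lia. Qed.

(** By [cdistE], a detour through [j] lengthens the path from [i] to [k] by a whole number of turns,
    namely the excess of the winding numbers. *)
Lemma windD i j k :
  (wind i j + wind j k == wind i k) = (cdist i j + cdist j k <= n)%N.
Proof.
have := cdistE i j; have := cdistE j k; have := cdistE i k.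
by have := cdist_le i k; rewrite /wind; lia.
Qed.

Lemma cdist_inj i : injective (cdist i).
Proof.
move=> j k; have := cdistE i j; have := cdistE i k; rewrite /wind => Ek Ej E.
by apply: val_inj => /=; have := ltn_ord j; have := ltn_ord k; lia.
Qed.

(** The path from [ordS b] to [b] has [n] arrows and visits every vertex once. *)
Lemma cdist_ordSl b k : (cdist (ordS b) k + cdist k b = n)%N.
Proof.
have := cdistE (ordS b) k; have := cdistE k b; rewrite /wind val_ordS.
have := ltn_ord b; have := ltn_ord k; have := cdist_le k b.
have := cdist_le (ordS b) k; case: ifP => /eqP; lia.
Qed.

Lemma cdist_ordSr k b :
  cdist k (ordS b) = if ordS b == k then 0 else (cdist k b).+1.
Proof.
case: eqP => [->|/eqP nbk]; first exact: cdistii.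
have := cdistE k (ordS b); have := cdistE k b; rewrite /wind val_ordS.
have := ltn_ord b; have := ltn_ord k; have := cdist_le k b.
have := cdist_le k (ordS b).
by move: nbk; rewrite ordS_eq; case: ifP => /eqP; lia.
Qed.

Lemma cdist_ordS_lt k b : k != b -> cdist k b = (cdist (ordS k) b).+1.
Proof.
move=> nkb; have := cdistE (ordS k) b; have := cdistE k b.
rewrite /wind val_ordS; have := ltn_ord b; have := ltn_ord k.
have := cdist_le k b; have := cdist_le (ordS k) b.
by move: nkb; rewrite -val_eqE /=; case: ifP => /eqP; lia.
Qed.

Lemma cdist_eq_n k b : (cdist k b == n) = (ordS b == k).
Proof.
have E := cdist_ordSl b k; apply/eqP/eqP => [Dn|Sb].
  by apply: (@cdist_inj (ordS b)); rewrite cdistii; lia.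
by move: E; rewrite Sb cdistii.
Qed.

End CyclicDistance.

(** * Lattices and the maps between their reductions *)

Section Lattices.
Variables (R : idomainType) (pi : R) (kappa : fieldType).
Variables (res : {rmorphism R -> kappa}) (d : nat).
Hypotheses (pi_neq0 : pi != 0) (hres : residue_morphism pi res).
Implicit Types L : set 'rV[{fraction R}]_d.

Let piF_neq0 : pi%:F != 0 :> {fraction R}.
Proof. by rewrite tofrac_eq0. Qed.

Lemma latticeD L x y : lattice L -> L x -> L y -> L (x + y).
Proof.
by move=> [B [_ ->]] [u _ <-] [w _ <-]; exists (u + w); rewrite // map_mxD mulmxDl.
Qed.

Lemma latticeZ L (a : R) x : lattice L -> L x -> L (a%:F *: x).
Proof.
move=> [B [_ ->]] [u _ <-]; exists (a *: u) => //.
by rewrite map_mxZ scalemxAl.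
Qed.

Lemma latticeB L x y : lattice L -> L x -> L y -> L (x - y).
Proof.
move=> hL Lx Ly; apply: latticeD => //.
by rewrite -scaleN1r -tofrac1 -tofracN; apply: latticeZ.
Qed.

Lemma lattice_pi_exp L (m : nat) x : lattice L -> L x -> L (pi%:F ^+ m *: x).
Proof. by move=> hL Lx; rewrite -tofracXn; apply: latticeZ. Qed.

Lemma shift_exponent_min L1 L2 (m : int) :
    scale_set (pi%:F ^ m) L1 `<=` L2 ->
    (forall m' : int, scale_set (pi%:F ^ m') L1 `<=` L2 -> m <= m') ->
  shift_exponent pi L1 L2 = m.
Proof.
move=> mL mmin; rewrite /shift_exponent; case: xgetP => [m' _ [m'L m'min]|].
  by apply/eqP; rewrite eq_le m'min //= mmin.
by move=> /(_ m) /=; case.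
Qed.

(* If [0] were not minimal, a minimal [m < 0] would contradict [2 m]; when
   there is no minimum ([d = 0]) the default value is the right one. *)
Lemma shift_exponent_refl L : shift_exponent pi L L = 0.
Proof.
rewrite /shift_exponent; case: xgetP => [m _ [mL mmin]|//].
have m_le0 : m <= 0 by apply: mmin => _ [x Lx <-]; rewrite expr0z scale1r.
have : m <= m + m.
  apply: mmin => _ [x Lx <-]; rewrite expfzDr // -scalerA.
  by apply: (mL); exists (pi%:F ^ m *: x) => //; apply: mL; exists x.
by lia.
Qed.

Section InducedMap.
Variables (Lu Lv : set 'rV[{fraction R}]_d).
Hypotheses (hLu : lattice Lu) (hLv : lattice Lv).
Variables (Mu : reduction pi res Lu) (Mv : reduction pi res Lv).

Lemma red_map_scale_pi x : Lu x -> red_map Mu (pi%:F *: x) = 0.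
Proof. by move=> Lx; apply/red_map_ker; [exact: latticeZ | exists x]. Qed.

Lemma red_mapB x y : Lu x -> Lu y ->
  red_map Mu (x - y) = red_map Mu x - red_map Mu y.
Proof.
move=> Lx Ly; rewrite -[in LHS]scaleN1r -tofrac1 -tofracN red_mapD //.
  by rewrite red_mapZ // rmorphN rmorph1 scaleN1r.
exact: latticeZ.
Qed.

(** Two lifts differ by an element of $\pi L_u$, which lands in $\pi L_v$, so the lift chosen by
    [xget] does not matter. Hence the underlying function is linear, and [linfun] agrees with it. *)
Lemma induced_mapE x :
    (forall z, Lu z -> Lv (pi%:F ^ shift_exponent pi Lu Lv *: z)) -> Lu x ->
  induced_map Mu Mv (red_map Mu x)
    = red_map Mv (pi%:F ^ shift_exponent pi Lu Lv *: x).
Proof.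
set c := pi%:F ^ _ => shiftP Lx.
pose lift y := xget 0 [set x | Lu x /\ red_map Mu x = y].
have liftP y : Lu (lift y) /\ red_map Mu (lift y) = y.
  rewrite /lift; case: xgetP => [z _ //|none].
  by have [z Lz zy] := red_map_surj y; have := none z; case.
pose g y := red_map Mv (c *: lift y).
have gE z : Lu z -> g (red_map Mu z) = red_map Mv (c *: z).
  move=> Lz; have [Ll El] := liftP (red_map Mu z); rewrite /g.
  have : red_map Mu (lift (red_map Mu z) - z) = 0 by rewrite red_mapB // El subrr.
  move/red_map_ker => /(_ (latticeB hLu Ll Lz)) [w Lw Ew].
  have -> : lift (red_map Mu z) = z + pi%:F *: w by rewrite Ew addrC subrK.
  rewrite scalerDr scalerA mulrC -scalerA red_mapD; last 2 first.
  - exact: shiftP.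
  - by apply: latticeZ => //; exact: shiftP.
  rewrite [X in _ + X](_ : _ = 0) ?addr0 //.
  by apply/red_map_ker; [apply: latticeZ => //|exists (c *: w)] => //; exact: shiftP.
have glin : linear g.
  move=> a y z; have [b <-] := hres.1 a.
  have [u Luu <-] := red_map_surj y; have [w Luw <-] := red_map_surj z.
  rewrite -red_mapZ // -red_mapD //; last exact: latticeZ.
  rewrite !gE //; last by apply: latticeD => //; exact: latticeZ.
  rewrite scalerDr scalerA mulrC -scalerA red_mapD.
  - by rewrite red_mapZ //; exact: shiftP.
  - by apply: latticeZ => //; exact: shiftP.
  - exact: shiftP.
pose glin' := GRing.isLinear.Build _ _ _ _ g glin.
pose gL : {linear red_space Mu -> red_space Mv} := HB.pack g glin'.
rewrite -gE //; exact: (lfunE gL).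
Qed.

End InducedMap.

Section LatticeChain.
Variables (n : nat) (L : 'I_n.+1 -> set 'rV[{fraction R}]_d).
Hypotheses (hL : forall i, lattice (L i))
  (hinj : injective (fun i => homothety_class (L i)))
  (hchain : forall i j : 'I_n.+1, (i <= j)%N -> L i `<=` L j)
  (hlast : L ord_max `<=` scale_set (pi%:F)^-1 (L ord0))
  (M : forall i, reduction pi res (L i)).
Implicit Types i j k : 'I_n.+1.

Lemma pi_chain i j x : L i x -> L j (pi%:F *: x).
Proof.
move=> Lx; have /hlast [y Ly <-] : L ord_max x.
  by apply: hchain Lx; rewrite -ltnS ltn_ord.
by rewrite scalerA divff // scale1r; apply: hchain Ly.
Qed.

Lemma wind_chain i j x : L i x -> L j (pi%:F ^+ wind i j *: x).
Proof.
move=> Lx; rewrite /wind; case: ltnP => [_|le_ij]; first exact: pi_chain Lx.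
by rewrite expr0 scale1r; apply: hchain Lx.
Qed.

Lemma homothety_class_scale (c : {fraction R}) (L1 L2 : set 'rV[{fraction R}]_d) :
  c != 0 -> L1 = scale_set c L2 -> homothety_class L1 = homothety_class L2.
Proof.
move=> c0 ->; apply/seteqP; split=> _ [a /= a0 <-].
  exists (a * c); first exact: mulf_neq0.
  apply/seteqP; split=> [_ [x Lx <-]|_ [_ [x Lx <-] <-]].
    by exists (c *: x); [exists x | rewrite scalerA].
  by exists x; rewrite // scalerA.
exists (a / c); first by rewrite /= mulf_neq0 ?invr_eq0.
apply/seteqP; split=> [_ [_ [x Lx <-] <-]|_ [x Lx <-]].
  by exists x; rewrite // scalerA divfK.
by exists (c *: x); [exists x | rewrite scalerA divfK].
Qed.

(* A smaller exponent would force [L i = pi ^ wind j i L j]. *)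
Lemma shift_exponent_chain i j : shift_exponent pi (L i) (L j) = (wind i j)%:Z.
Proof.
have [->|nij] := eqVneq i j; first by rewrite shift_exponent_refl /wind ltnn.
apply: shift_exponent_min => [_ [x Lx <-]|m mL]; first exact: wind_chain.
rewrite leNgt; apply/negP => m_lt.
pose s := wind j i; have sE : (wind i j + s = 1)%N.
  by move: nij; rewrite /s /wind -val_eqE /=; lia.
have [p mE] : exists p : nat, m = - (s + p)%:Z.
  by exists `|(m + s%:Z)%R|%N; lia.
have sub x : L i x -> exists2 y, L j y & x = pi%:F ^+ s *: y.
  move=> Lx; exists (pi%:F ^+ p *: (pi%:F ^ m *: x)).
    by apply: lattice_pi_exp => //; apply: mL; exists x.
  by rewrite !scalerA -exprD mE -exprnN mulfV ?scale1r // expf_neq0.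
case/eqP: nij; apply: hinj; apply: (@homothety_class_scale (pi%:F ^+ s)).
  exact: expf_neq0.
apply/seteqP; split=> [x /sub[y Ly ->]|_ [y Ly <-]]; first by exists y.
exact: wind_chain.
Qed.

Let f i j := induced_map (M i) (M j).

Lemma chain_mapE i j x : L i x ->
  f i j (red_map (M i) x) = red_map (M j) (pi%:F ^+ wind i j *: x).
Proof.
move=> Lx; rewrite induced_mapE // ?shift_exponent_chain //.
by move=> z; apply: wind_chain.
Qed.

Lemma chain_map_refl i v : f i i v = v.
Proof.
have [x Lx <-] := red_map_surj v.
by rewrite chain_mapE // /wind ltnn expr0 scale1r.
Qed.

(** The exponents add up to [wind i k] on less than a full turn; otherwise one more factor [pi] is
    left over and vanishes in the reduction. *)
Lemma chain_map_comp i j k v : f j k (f i j v) =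
  if (cdist i j + cdist j k <= n)%N then f i k v else 0.
Proof.
have [x Lx <-] := red_map_surj v; rewrite -windD.
rewrite !chain_mapE //; last exact: wind_chain.
rewrite scalerA -exprD; case: eqP => [<-|ne]; first by rewrite addnC.
have -> : (wind j k + wind i j = 1 + wind i k)%N by move: ne; rewrite /wind; lia.
rewrite exprD expr1 -scalerA red_map_scale_pi //.
exact: wind_chain.
Qed.

(** The exponents of the two directions add up to 1, so a vector killed on the way to [j] is
    [pi ^ wind j i] times an element of [L j]. *)
Lemma chain_map_exact i j : i != j -> (lker (f i j) <= limg (f j i))%VS.
Proof.
move=> nij; apply/subvP => v; rewrite memv_ker => /eqP.
have [x Lx <-] := red_map_surj v; rewrite chain_mapE //.
move/red_map_ker => /(_ (wind_chain _ Lx)) [z Lz zE].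
have -> : x = pi%:F ^+ wind j i *: z.
  move: nij Lz zE; rewrite -val_eqE /= /wind neq_ltn => /orP[] lt_ij _.
    by rewrite lt_ij ltnNge ltnW //= expr0 expr1 scale1r.
  rewrite lt_ij ltnNge ltnW //= expr0 expr1 scale1r.
  by move/(scalerI piF_neq0).
by rewrite -chain_mapE // memv_img // memvf.
Qed.

End LatticeChain.

End Lattices.

(** * Sub-representations of an exact cyclic representation *)

Section CyclicRepresentation.
Variables (kappa : fieldType) (n : nat) (V : 'I_n.+1 -> vectType kappa).
Variable f : forall i j : 'I_n.+1, 'Hom(V i, V j).
Hypotheses
  (f_refl : forall i v, f i i v = v)
  (f_comp : forall i j k v, f j k (f i j v) =
     if (cdist i j + cdist j k <= n)%N then f i k v else 0)
  (f_exact : forall i j, i != j -> (lker (f i j) <= limg (f j i))%VS).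
Implicit Types (i j k l b : 'I_n.+1) (U : forall i, {vspace V i}).

(* The full turn acts as [pi], that is, as zero; for [n = 0] the arrow of the
   quiver is a full turn, whereas [f b b] is the identity. *)
Definition next_map b : 'Hom(V b, V (ordS b)) :=
  if ordS b == b then 0 else f b (ordS b).

Lemma next_map_comp k b v :
  next_map b (f k b v) = if ordS b == k then 0 else f k (ordS b) v.
Proof.
rewrite /next_map; have [Sb|nSb] := eqVneq (ordS b) b.
  rewrite lfunE /=; have Dbk := cdist_ordSl b k.
  suff -> : ordS b == k by [].
  (* A vertex that is its own successor forces [n = 0]. *)
  have := cdist_ordSl b b; rewrite {1}Sb cdistii => n0.
  by rewrite -cdist_eq_n; have := cdist_le k b; lia.
rewrite f_comp cdist_ordSr (negbTE nSb) cdistii addn1.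
by rewrite ltn_neqAle cdist_le andbT cdist_eq_n; case: eqP.
Qed.

(** The premise is an equation so that [ordS b = b] can be used without a cast between vector
    spaces. *)
Lemma limg_f_eq a b : a = b -> limg (f a b) = fullv.
Proof.
move=> ->; apply/vspaceP => v; rewrite memvf -[v]f_refl.
by rewrite memv_img // memvf.
Qed.

Lemma lker_next_map b : (lker (next_map b) <= limg (f (ordS b) b))%VS.
Proof.
rewrite /next_map; have [/limg_f_eq -> |nSb] := eqVneq; first exact: subvf.
by apply: f_exact; rewrite eq_sym.
Qed.

Section SubRepresentation.
Variable U : forall i, {vspace V i}.
Hypothesis Usub : forall i, (f i (ordS i) @: U i <= U (ordS i))%VS.

(* The number of indecomposable summands of [U] that contain [k] and whose
   socle is at [b]. *)
Definition socle_rank k b : nat := \dim ((f k b @: U k) :&: lker (next_map b)).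

(** Rank-nullity for [next_map b] on the image of [U k] at [b]. *)
Lemma rank_vector_next k b : rank_vector f U k b =
  (socle_rank k b + if ordS b == k then 0 else rank_vector f U k (ordS b))%N.
Proof.
rewrite /rank_vector -(limg_ker_dim (next_map b)); congr addn.
rewrite -limg_comp; case: eqP => [Sb|/eqP nSb].
  apply/eqP; rewrite dimv_eq0 -subv0; apply/subvP => _ /memv_imgP[u _ ->].
  by rewrite comp_lfunE /= next_map_comp Sb eqxx mem0v.
congr (\dim (_ @: _)%VS); apply/lfunP => u.
by rewrite comp_lfunE next_map_comp (negbTE nSb).
Qed.

(** For [k != b], [f k b] factors through [ordS k], where [U] contains the image of [U k]. *)
Lemma socle_rank_mono k b : k != b -> (socle_rank k b <= socle_rank (ordS k) b)%N.
Proof.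
move=> nkb; apply/dimvS/capvS => //; have Dkb := cdist_ordS_lt nkb.
have nSk : ordS k != k.
  by apply/eqP => Sk; move: Dkb; rewrite Sk; lia.
apply/subvP => _ /memv_imgP[u Uu ->].
have -> : f k b u = f (ordS k) b (f k (ordS k) u).
  rewrite f_comp cdist_ordSr (negbTE nSk) cdistii.
  by rewrite add1n -Dkb cdist_le.
by apply/memv_img/(subvP (Usub k))/memv_img.
Qed.

Lemma socle_rank_diag i : (socle_rank i i <= \dim (lker (next_map i)))%N.
Proof. exact/dimvS/capvSr. Qed.

End SubRepresentation.

(** * A sub-representation with prescribed socle ranks [h] *)

Section Construction.
Variable h : 'I_n.+1 -> 'I_n.+1 -> nat.
Hypotheses
  (h_mono : forall k b, k != b -> (h k b <= h (ordS k) b)%N)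
  (h_diag : forall b, (h b b <= \dim (lker (next_map b)))%N).

(** Initial segments of one fixed basis, so that these spaces are nested in [m]. *)
Let W b m : {vspace V b} := <<take m (vbasis (lker (next_map b)))>>%VS.

(** One lift to [ordS b] serves all [k], so [f] carries these transports to one another. *)
Let phi b k : 'Hom(V b, V k) := (f (ordS b) k \o (f (ordS b) b)^-1)%VF.

(* [phi b k] transports the socle vectors at [b] back to the vertex [k]. *)
Definition socle_span k : {vspace V k} := (\sum_b phi b k @: W b (h k b))%VS.

Let W_lker b m : (W b m <= lker (next_map b))%VS.
Proof.
apply/span_subvP => v /mem_take; exact: vbasis_mem.
Qed.

Let W_mono b m1 m2 : (m1 <= m2)%N -> (W b m1 <= W b m2)%VS.
Proof.
move=> le_m; apply: sub_span => v; rewrite -(take_takel _ le_m).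
exact: mem_take.
Qed.

Let dim_W b k : \dim (W b (h k b)) = h k b.
Proof.
(* [h] grows along the path from [k] to [b]; with [h_diag], [take] then finds enough basis
   vectors. *)
have hb : (h k b <= h b b)%N.
  move: {2}(cdist k b) (erefl (cdist k b)) => D.
  elim: D k => [|D IH] k DE.
    by rewrite (@cdist_inj _ k k b) // cdistii DE.
  have nkb : k != b by apply: contra_eqN DE => /eqP ->; rewrite cdistii.
  apply: leq_trans (h_mono nkb) (IH _ _).
  by move: DE; rewrite (cdist_ordS_lt nkb) => -[].
have /eqP-> : free (take (h k b) (vbasis (lker (next_map b)))).
  have := basis_free (vbasisP (lker (next_map b))).
  by rewrite -{1}(cat_take_drop (h k b) (vbasis _)) => /catl_free.
by rewrite size_takel // size_tuple (leq_trans hb).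
Qed.

(** The path from [ordS b] through [k] to [l] stays below a full turn exactly when [l] comes no
    later than [b] on the way from [k]. *)
Let f_phi b k l w : f k l (phi b k w) =
  if (cdist k l <= cdist k b)%N then phi b l w else 0.
Proof.
rewrite !comp_lfunE /= f_comp; congr (if _ then _ else _).
by have := cdist_ordSl b k; lia.
Qed.

Let phi_diag b w : w \in lker (next_map b) -> phi b b w = w.
Proof.
by move=> /(subvP (lker_next_map b)) wf; rewrite comp_lfunE limg_lfunVK.
Qed.

Let f_phi_back b l w : w \in lker (next_map b) -> f l b (phi b l w) = w.
Proof. by move=> wK; rewrite f_phi leqnn phi_diag. Qed.

(* Apply [f l b], where [b] maximises [cdist l b] among the nonzero terms: this
   kills all the other terms. *)
Let phi_directv (P : pred 'I_n.+1) l :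
  directv (\sum_(b | P b) phi b l @: lker (next_map b)).
Proof.
apply/directv_sum_independent => us usP sum0 b0 Pb0.
apply/eqP; apply/negPn/negP => us0.
have Q0 : P b0 && (us b0 != 0) by rewrite Pb0.
case: (@arg_maxnP _ b0 (fun b => P b && (us b != 0)) (cdist l) Q0).
move=> b /andP[Pb /eqP usb] bmax; apply: usb.
have /memv_imgP[w wK usE] := usP b Pb; rewrite usE.
suff : f l b (us b) = 0 by rewrite usE f_phi_back // => ->; rewrite linear0.
move/(congr1 (f l b)): sum0; rewrite linear0 linear_sum (bigD1 b) //=.
rewrite big1 ?addr0 // => b' /andP[Pb' nb].
have /memv_imgP[w' _ us'E] := usP b' Pb'.
have [-> | us'0] := eqVneq (us b') 0; first by rewrite linear0.
rewrite us'E f_phi; case: ifP => // le_bb'.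
case/eqP: nb; apply: (@cdist_inj _ l); apply/eqP.
by rewrite eqn_leq le_bb' andbT; apply: bmax; rewrite Pb'.
Qed.

(** The summands whose socle comes before [l] die; the others keep their dimensions and stay
    independent by [phi_directv]. *)
Lemma rank_vector_socle_span k l : rank_vector f socle_span k l =
  (\sum_(b | (cdist k l <= cdist k b)%N) h k b)%N.
Proof.
rewrite /rank_vector /socle_span limg_sum.
pose P b := (cdist k l <= cdist k b)%N.
have -> : (\sum_b f k l @: (phi b k @: W b (h k b)) =
           \sum_(b | P b) phi b l @: W b (h k b))%VS.
  rewrite [RHS]big_mkcond /=; apply: eq_bigr => b _; rewrite -limg_comp.
  case: ifP => Pb.
    by congr (_ @: _)%VS; apply/lfunP => w; rewrite comp_lfunE f_phi -/(P b) Pb.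
  apply/eqP; rewrite -subv0; apply/subvP => _ /memv_imgP[w _ ->].
  by rewrite comp_lfunE f_phi -/(P b) Pb mem0v.
have W_phi b : (phi b l @: W b (h k b) <= phi b l @: lker (next_map b))%VS.
  exact: limgS.
have dim_phi b : \dim (phi b l @: W b (h k b)) = h k b.
  (* [f l b] undoes [phi b l] on socle vectors, so [phi b l] is injective there. *)
  rewrite limg_dim_eq ?dim_W //; apply/eqP; rewrite -subv0.
  apply/subvP => w /memv_capP[/(subvP (W_lker _ _)) wK].
  by rewrite memv_ker => /eqP w0; rewrite -(f_phi_back l wK) w0 linear0 mem0v.
transitivity (\sum_(b | P b) \dim (phi b l @: W b (h k b)))%N; last first.
  by apply: eq_bigr => b _.
(* Directness unfolds to this equality of dimensions. *)
apply/eqP; change (directv (\sum_(b | P b) phi b l @: W b (h k b))).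
apply/directv_sum_independent => us usP.
apply: (directv_sum_independent (phi_directv P l)) => b Pb.
exact: subvP (W_phi b) _ (usP b Pb).
Qed.

Lemma socle_span_sub i : (f i (ordS i) @: socle_span i <= socle_span (ordS i))%VS.
Proof.
rewrite /socle_span limg_sum; apply/subv_sumP => b _; rewrite -limg_comp.
apply/subvP => _ /memv_imgP[w wW ->]; rewrite comp_lfunE f_phi.
case: ifP => [le_D|_]; last exact: mem0v.
apply: (subvP (sumv_sup b _ (subvv _))) => //; apply: memv_img.
have [ib|nib] := eqVneq i b; last exact: (subvP (W_mono _ (h_mono nib))).
(* At [i = b] the bound [le_D] leaves only the loop, [ordS b = b]. *)
move: le_D wW; rewrite {}ib cdistii leqn0 cdist_ordSr.
by case: (ordS b =P b) => // ->.
Qed.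
End Construction.
End CyclicRepresentation.

(** * Differences of extended tuples *)

Section ExtendTuple.
Variables (n : nat) (t : index_J n -> int).
Local Notation e := (extend_tuple t).
Implicit Types k l b : 'I_n.+1.

(* For [e] coming from a sub-representation, the number of its indecomposable
   summands that contain [k] and whose socle is at [b]. *)
Definition tuple_drop k b : int :=
  e k%:Z (k%:Z + (cdist k b)%:Z) - e k%:Z (k%:Z + (cdist k b)%:Z + 1).

(** Turns the index [i - 1] of (1) into a vertex; at [k = n] it is [-1], one period away. *)
Lemma extend_tuple_ordS_pred k (s : int) :
  e ((ordS k)%:Z - 1) ((ordS k)%:Z - 1 + s) = e k%:Z (k%:Z + s).
Proof.
rewrite val_ordS; case: eqP => [kn|_]; last by rewrite -addn1 PoszD addrK.
rewrite -extend_tuple_periodic; congr extend_tuple; lia.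
Qed.

Lemma extend_tuple_next k b :
  e k%:Z (k%:Z + (cdist k b)%:Z + 1) =
  if ordS b == k then 0 else e k%:Z (k%:Z + (cdist k (ordS b))%:Z).
Proof.
rewrite cdist_ordSr -cdist_eq_n; case: eqP => [->|_].
  by rewrite extend_tuple_out //; lia.
by congr extend_tuple; lia.
Qed.

(** With [i = ordS k] and [b] the residue of [j], the second difference in (1) compares the drops at
    [b] from two successive starts. At [k = b], that is [j = i + n], both terms in [i - 1] are out
    of range, which accounts for the [0]. *)
Lemma tuple_drop_monoP :
  (forall i j : nat, (i <= n)%N -> (i <= j <= n + i)%N ->
     0 <= e i%:Z j%:Z + e (i%:Z - 1) (j%:Z + 1)
          - e i%:Z (j%:Z + 1) - e (i%:Z - 1) j%:Z) <->
  (forall k b, (if k == b then 0 else tuple_drop k b) <= tuple_drop (ordS k) b).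
Proof.
have stepE k b : let i := (ordS k)%:Z in let j := i + (cdist (ordS k) b)%:Z in
    e i j + e (i - 1) (j + 1) - e i (j + 1) - e (i - 1) j =
    tuple_drop (ordS k) b - (if k == b then 0 else tuple_drop k b).
  move=> i j; pose D := (cdist (ordS k) b)%:Z.
  have -> : e (i - 1) (j + 1) = e k%:Z (k%:Z + (D + 2)).
    by rewrite -extend_tuple_ordS_pred; congr extend_tuple; rewrite /j /D; lia.
  have -> : e (i - 1) j = e k%:Z (k%:Z + (D + 1)).
    by rewrite -extend_tuple_ordS_pred; congr extend_tuple; rewrite /j /D; lia.
  rewrite /tuple_drop -/i -/j; have [kb|nkb] := eqVneq k b.
    have -> : D = n%:Z by rewrite /D kb; congr Posz; apply/eqP; rewrite cdist_eq_n.
    rewrite (@extend_tuple_out _ _ k%:Z (k%:Z + (n%:Z + 2))); last by lia.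
    rewrite (@extend_tuple_out _ _ k%:Z (k%:Z + (n%:Z + 1))); last by lia.
    by rewrite addr0 !subr0.
  rewrite (cdist_ordS_lt nkb).
  have -> : k%:Z + (D + 2) = k%:Z + (cdist (ordS k) b).+1%:Z + 1 by rewrite /D; lia.
  have -> : k%:Z + (D + 1) = k%:Z + (cdist (ordS k) b).+1%:Z by rewrite /D; lia.
  by lia.
split=> [He k b|He i j le_in le_ij].
  rewrite -subr_ge0 -stepE; apply: He; first by rewrite -ltnS ltn_ord.
  by have := cdist_le (ordS k) b; lia.
(* Since [j <= n + i <= 2n], one subtraction reduces [j] modulo [n + 1]. *)
pose k := ord_pred (inord i : 'I_n.+1).
have kE : ordS k = i :> nat by rewrite ord_predK inordK.
pose b : 'I_n.+1 := inord (if (j <= n)%N then j else j - n.+1)%N.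
have bE : j = (i + cdist (ordS k) b)%N.
  have := cdistE (ordS k) b; have := cdist_le (ordS k) b; rewrite /wind kE.
  by rewrite /b inordK; case: ifP; lia.
have := stepE k b; rewrite kE => /= E.
by rewrite bE PoszD E subr_ge0.
Qed.

(** Induction along the path from [ordS b], where the hypothesis at [k = b] gives the bound; [m]
    counts the arrows from [ordS b] to [k]. *)
Lemma tuple_drop_ge0 k b :
    (forall k b, (if k == b then 0 else tuple_drop k b) <= tuple_drop (ordS k) b) ->
  0 <= tuple_drop k b.
Proof.
move=> He; have [m mE] : exists m, (cdist k b + m = n)%N.
  by exists (n - cdist k b)%N; have := cdist_le k b; lia.
elim: m k mE => [|m IH] k mE.
  have /eqP <- : ordS b == k by rewrite -cdist_eq_n; lia.
  by have := He b b; rewrite eqxx.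
have := He (ord_pred k) b; rewrite ord_predK; apply: le_trans.
case: eqVneq => // nkb; apply: IH.
by have := cdist_ordS_lt nkb; rewrite ord_predK; lia.
Qed.

(** [cdist k] is a bijection onto [0..n]; after reindexing, the sum telescopes up to the index
    [n + 1], where the tuple is zero. *)
Lemma sum_tuple_drop k l :
  \sum_(b | (cdist k l <= cdist k b)%N) tuple_drop k b =
  e k%:Z (k%:Z + (cdist k l)%:Z).
Proof.
pose F s := e k%:Z (k%:Z + s%:Z).
have dropE b : tuple_drop k b = F (cdist k b) - F (cdist k b).+1.
  by rewrite /tuple_drop /F; congr (_ - extend_tuple _ _ _); lia.
pose c b : 'I_n.+1 := inord (cdist k b).
have cE b : c b = cdist k b :> nat by rewrite inordK // ltnS cdist_le.
have c_inj : injective c.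
  by move=> b b' /(congr1 val) /=; rewrite !cE => /cdist_inj.
transitivity (\sum_(s < n.+1 | (cdist k l <= s)%N) (F s - F s.+1)).
  rewrite [RHS](reindex_inj c_inj) /=.
  by apply: eq_big => b; rewrite cE // dropE.
rewrite -(big_geq_mkord _ _ xpredT (fun s => F s - F s.+1)).
under eq_bigr do rewrite -opprB.
rewrite sumrN telescope_sumr ?opprB; last by rewrite (leqW (cdist_le _ _)).
by rewrite /F (@extend_tuple_out _ _ _ (_ + n.+1%:Z)) ?subr0 //; lia.
Qed.

(** The pairs [(k, k + cdist k l)] run exactly once through $J$. *)
Lemma rank_tupleP (Phi : 'I_n.+1 -> 'I_n.+1 -> nat) :
  rank_tuple Phi = t <->
  (forall k l, e k%:Z (k%:Z + (cdist k l)%:Z) = (Phi k l)%:Z).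
Proof.
have tE k l : exists p : index_J n,
    e k%:Z (k%:Z + (cdist k l)%:Z) = t p /\ rank_tuple Phi p = (Phi k l)%:Z.
  have hp : (k <= n)%N && (k <= k + cdist k l <= n + k)%N.
    by have := cdist_le k l; have := ltn_ord k; lia.
  exists (exist _ (k : nat, (k + cdist k l)%N) hp); split.
    by rewrite -extend_tuple_J.
  rewrite /rank_tuple /=; congr (Phi _ _)%:Z; apply: val_inj; rewrite /= inordK //.
    rewrite cdistE /wind; have := ltn_ord l; have := ltn_ord k.
    by case: ifP; lia.
  rewrite cdistE /wind; have := ltn_ord l; have := ltn_ord k.
  by case: ifP; lia.
split=> [Et k l|He].
  by have [p [-> <-]] := tE k l; rewrite Et.
apply/funext => -[[i j] hij]; rewrite /rank_tuple /= -He -extend_tuple_J /=.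
have /= /andP[le_in le_ij] := hij.
set k := inord i; set l := inord _.
have kE : k = i :> nat by rewrite inordK.
have := cdistE k l; have := cdist_le k l; rewrite /wind kE.
have lE : l = (if j <= n then j else j - n.+1)%N :> nat.
  by rewrite inordK //; case: ifP; lia.
move=> D1 D2; congr extend_tuple; move: D1 D2; rewrite lE; case: ifP; lia.
Qed.

End ExtendTuple.

(** * Rank vectors of sub-representations of $M_\Gamma$ *)

Lemma tuple_drop_rank (kappa : fieldType) (n : nat) (V : 'I_n.+1 -> vectType kappa)
    (f : forall i j : 'I_n.+1, 'Hom(V i, V j)) (U : forall i, {vspace V i})
    (k b : 'I_n.+1) :
    (forall i j k v, f j k (f i j v) =
       if (cdist i j + cdist j k <= n)%N then f i k v else 0) ->
  tuple_drop (rank_tuple (rank_vector f U)) k b = (socle_rank f U k b)%:Z.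
Proof.
move=> f_comp; have /rank_tupleP E := erefl (rank_tuple (rank_vector f U)).
rewrite /tuple_drop extend_tuple_next !E (rank_vector_next f_comp).
by case: ifP; lia.
Qed.

Theorem proposition4p20
  (R : idomainType) (pi : R) (kappa : closedFieldType)
  (res : {rmorphism R -> kappa})
  (hR : dvr_with_uniformizer pi) (hres : residue_morphism pi res)
  (d n : nat) (L : 'I_n.+1 -> set 'rV[{fraction R}]_d)
  (hL : forall i, lattice (L i))
  (hinj : injective (fun i => homothety_class (L i)))
  (hGamma : building_simplex pi (range (fun i => homothety_class (L i))))
  (hchain : forall i j : 'I_n.+1, (i <= j)%N -> L i `<=` L j)
  (hlast : L ord_max `<=` scale_set (pi%:F)^-1 (L ord0))
  (M : forall i, reduction pi res (L i))
  (x : 'I_n.+1 -> nat) :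
  let f := fun i j => induced_map (M i) (M j) in
  let PhiM := extend_tuple (rank_tuple (rank_vector f (fun i => fullv))) in
  (forall t : index_J n -> int,
    let e := extend_tuple t in
    [set rank_tuple (rank_vector f U) | U in quiver_grassmannian f x] t <->
    (forall i j : nat, (i <= n)%N -> (i <= j <= n + i)%N ->
       0 <= e i%:Z j%:Z + e (i%:Z - 1) (j%:Z + 1)
            - e i%:Z (j%:Z + 1) - e (i%:Z - 1) j%:Z) /\
    (forall i : 'I_n.+1,
       let k := (i : nat)%:Z in
       e k k = (x i)%:Z /\ e k k - e k (k + 1) <= PhiM k k - PhiM k (k + 1))) /\
  ((0 < n)%N -> forall i : 'I_n.+1,
     let k := (i : nat)%:Z in
     PhiM k k - PhiM k (k + 1) = (\dim (lker (f i (ordS i))))%:Z).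
Proof.
move=> f PhiM.
have pi_neq0 : pi != 0 by case: hR => v [].
have f_refl := @chain_map_refl _ _ _ _ _ pi_neq0 hres n L hL hinj hchain hlast M.
have f_comp := @chain_map_comp _ _ _ _ _ pi_neq0 hres n L hL hinj hchain hlast M.
have f_exact := @chain_map_exact _ _ _ _ _ pi_neq0 hres n L hL hinj hchain hlast M.
have f_id i (U : {vspace red_space (M i)}) : (f i i @: U)%VS = U.
  have -> : f i i = \1%VF by apply/lfunP => v; rewrite f_refl id_lfunE.
  exact: lim1g.
have dropii t (i : 'I_n.+1) : tuple_drop t i i =
    extend_tuple t i%:Z i%:Z - extend_tuple t i%:Z (i%:Z + 1).
  by rewrite /tuple_drop cdistii addr0.
(* For [n = 0] this kernel is the whole space, whereas [f i i] is the identity. *)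
have PhiME (i : 'I_n.+1) :
    PhiM i%:Z i%:Z - PhiM i%:Z (i%:Z + 1) = (\dim (lker (next_map f i)))%:Z.
  by rewrite -dropii tuple_drop_rank // /socle_rank f_id capfv.
split; last first.
  move=> n_gt0 i /=; rewrite PhiME /next_map; case: eqVneq => // Si.
  by have := cdist_ordSl i i; rewrite {1}Si cdistii; lia.
move=> t e; split.
  (* Necessity: the drops of [t] are the socle ranks of [U]. *)
  move=> [U [Usub Ux] tE]; have /rank_tupleP rE := tE.
  have dropE k b : tuple_drop t k b = (socle_rank f U k b)%:Z.
    by rewrite -tE tuple_drop_rank.
  split.
    apply/tuple_drop_monoP => k b; rewrite !dropE.
    by case: eqVneq => // nkb; rewrite lez_nat; apply: socle_rank_mono.
  move=> i k; split; last by rewrite PhiME -dropii dropE lez_nat socle_rank_diag.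
  by have := rE i i; rewrite cdistii addr0 /rank_vector f_id Ux.
move=> [/tuple_drop_monoP He ex].
have drop_ge0 k b := tuple_drop_ge0 k b He.
(* Sufficiency: the drops are natural numbers and serve as the prescribed socle ranks. *)
pose h k b := `|tuple_drop t k b|%N.
have hE k b : (h k b)%:Z = tuple_drop t k b by rewrite /h gez0_abs.
have h_mono k b : k != b -> (h k b <= h (ordS k) b)%N.
  by move=> /negbTE nkb; have := He k b; rewrite nkb -!hE.
have h_diag b : (h b b <= \dim (lker (next_map f b)))%N.
  by rewrite -lez_nat hE dropii -PhiME; have [] := ex b.
have rankE (k l : 'I_n.+1) : e k%:Z (k%:Z + (cdist k l)%:Z) =
    (rank_vector f (socle_span f h) k l)%:Z.
  rewrite rank_vector_socle_span // /e -sum_tuple_drop.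
  by rewrite (big_morph Posz PoszD (erefl _)); apply: eq_bigr => b _.
exists (socle_span f h); last exact/rank_tupleP.
split=> i; first exact: socle_span_sub.
have := rankE i i; rewrite cdistii addr0 /rank_vector f_id.
by have [-> _] := ex i; case.
Qed.
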